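(* Every polynomial identity of degree $\le 5$ satisfied by the bilinear operation $[x,y]=\alpha(x\wedge y)$ on the $\mathfrak{sl}(2,\mathbb{C})$-module $V(6)$ is a consequence of the defining identities for Malcev algebras, $$[a,b]+[b,a]\equiv 0,$$ $$[[[a,c],b],d]+[[[d,a],c],b]+[[[c,b],d],a]+[[[b,d],a],c]-[[a,b],[c,d]]\equiv 0,$$ and the 18-term identity $k(a,b,c,d,e)\equiv0$ of degree 5, where, writing $[x,y]$ as juxtaposition $xy$, $$\begin{aligned} k(a,b,c,d,e)={}&-(((ab)c)e)d+(((ab)e)d)c+(((ac)b)d)e-(((ac)d)e)b\\ &-(((ad)b)c)e-(((ad)c)b)e+(((ae)b)c)d+(((ae)c)b)d\\ &+(((bd)c)a)e-(((be)a)d)c+(((be)c)d)a-(((be)d)a)c\\ &+(((cd)a)e)b-(((cd)b)e)a+(((cd)e)a)b-(((ce)b)a)d\\ &+((ab)c)(de)+((ac)b)(de). \end{aligned}$$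
   Context: $V(6)$ is the 7-dimensional irreducible $\mathfrak{sl}(2,\mathbb{C})$-module with basis $v_6,v_4,v_2,v_0,v_{-2},v_{-4},v_{-6}$ of $H$-eigenvectors, where $H\cdot v_{6-2i}=(6-2i)v_{6-2i}$, $E\cdot v_{6-2i}=(7-i)v_{6-2(i-1)}$, $F\cdot v_{6-2i}=(i+1)v_{6-2(i+1)}$ (with $v_8=v_{-8}=0$). The map $\alpha\colon\Lambda^2V(6)\to V(6)$ is the (unique up to nonzero scalar) nonzero $\mathfrak{sl}(2,\mathbb{C})$-module morphism, normalized so that $[x,y]=\alpha(x\wedge y)$ is the anticommutative product with $[v_6,v_0]=20v_6$, $[v_6,v_{-2}]=10v_4$, $[v_6,v_{-4}]=4v_2$, $[v_6,v_{-6}]=v_0$, $[v_4,v_2]=-60v_6$, $[v_4,v_0]=-20v_4$, $[v_4,v_{-4}]=6v_0$, $[v_4,v_{-6}]=4v_{-2}$, $[v_2,v_0]=-20v_2$, $[v_2,v_{-2}]=-15v_0$, $[v_2,v_{-6}]=10v_{-4}$, $[v_0,v_{-2}]=-20v_{-2}$, $[v_0,v_{-4}]=-20v_{-4}$, $[v_0,v_{-6}]=20v_{-6}$, $[v_{-2},v_{-4}]=-60v_{-6}$, and all other products $[v_p,v_q]$ with $p>q$ equal to $0$. A polynomial identity of degree $\le n$ is a nonassociative polynomial over $\mathbb{C}$ of degree $\le n$ in the given operation which vanishes for all substitutions of elements of the algebra for the variables. An identity is a consequence of a set of identities if it is satisfied by every algebra over $\mathbb{C}$ (with an operation of the given kind)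 that satisfies all identities in the set. *)

(* Defs.v *)
From HB Require Import structures.
From mathcomp Require Import all_boot all_order all_algebra.
From mathcomp Require Import finmap zify ring reals complex monalg.

Set Implicit Arguments.
Unset Strict Implicit.
Unset Printing Implicit Defensive.

Import GRing.Theory.
Local Open Scope ring_scope.

(* Nonassociative monomials without unit: the free magma on x_0, x_1, ... *)
Inductive magma : Type := Var of nat | Mul of magma & magma.

Declare Scope magma_scope.
Delimit Scope magma_scope with mag.
Bind Scope magma_scope with magma.
Notation "x * y" := (Mul x y) : magma_scope.

Fixpoint magma_code (m : magma) : GenTree.tree nat :=
  match m with
  | Var i => GenTree.Leaf i
  | Mul m1 m2 => GenTree.Node 0 [:: magma_code m1; magma_code m2]
  end.

Fixpoint magma_decode (t : GenTree.tree nat) : option magma :=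
  match t with
  | GenTree.Leaf i => Some (Var i)
  | GenTree.Node _ [:: t1; t2] =>
      if magma_decode t1 is Some m1 then
        if magma_decode t2 is Some m2 then Some (Mul m1 m2) else None
      else None
  | _ => None
  end.

Lemma magma_codeK : pcancel magma_code magma_decode.
Proof. by elim=> [i|m1 IH1 m2 IH2] //=; rewrite IH1 IH2. Qed.

HB.instance Definition _ := Countable.copy magma (pcan_type magma_codeK).

Fixpoint mon_deg (m : magma) : nat :=
  match m with Var _ => 1 | Mul m1 m2 => mon_deg m1 + mon_deg m2 end.

Fixpoint mon_eval (A : Type) (mul : A -> A -> A) (s : nat -> A) (m : magma) :
    A :=
  match m with
  | Var i => s i
  | Mul m1 m2 => mul (mon_eval mul s m1) (mon_eval mul s m2)
  end.

Notation napoly K := {malg K[magma]}.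

Section Identities.
Variable K : fieldType.

Definition mon (m : magma) : napoly K := << m >>.

Definition degree_le (n : nat) (p : napoly K) : Prop :=
  forall m, m \in msupp p -> (mon_deg m <= n)%N.

Definition na_eval (A : lmodType K) (mul : A -> A -> A) (s : nat -> A)
    (p : napoly K) : A :=
  \sum_(m <- msupp p) p@_m *: mon_eval mul s m.

Definition satisfies (A : lmodType K) (mul : A -> A -> A) (p : napoly K) :
    Prop :=
  forall s : nat -> A, na_eval mul s p = 0.

Definition consequence (S : seq (napoly K)) (p : napoly K) : Prop :=
  forall (A : lmodType K) (mul : {bilinear A -> A -> A}),
    (forall q, q \in S -> satisfies mul q) -> satisfies mul p.

Definition anticomm (a b : magma) : napoly K := mon (a * b) + mon (b * a).

Definition malcev (a b c d : magma) : napoly K :=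
    mon (((a * c) * b) * d) + mon (((d * a) * c) * b)
  + mon (((c * b) * d) * a) + mon (((b * d) * a) * c)
  - mon ((a * b) * (c * d)).

Definition kpoly (a b c d e : magma) : napoly K :=
  - mon ((((a * b) * c) * e) * d) + mon ((((a * b) * e) * d) * c)
  + mon ((((a * c) * b) * d) * e) - mon ((((a * c) * d) * e) * b)
  - mon ((((a * d) * b) * c) * e) - mon ((((a * d) * c) * b) * e)
  + mon ((((a * e) * b) * c) * d) + mon ((((a * e) * c) * b) * d)
  + mon ((((b * d) * c) * a) * e) - mon ((((b * e) * a) * d) * c)
  + mon ((((b * e) * c) * d) * a) - mon ((((b * e) * d) * a) * c)
  + mon ((((c * d) * a) * e) * b) - mon ((((c * d) * b) * e) * a)
  + mon ((((c * d) * e) * a) * b) - mon ((((c * e) * b) * a) * d)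
  + mon (((a * b) * c) * (d * e)) + mon (((a * c) * b) * (d * e)).

Definition anticomm_id : napoly K := anticomm (Var 0) (Var 1).
Definition malcev_id : napoly K := malcev (Var 0) (Var 1) (Var 2) (Var 3).
Definition k_id : napoly K := kpoly (Var 0) (Var 1) (Var 2) (Var 3) (Var 4).

End Identities.

Notation V6 R := 'rV[R[i]]_7.

Section V6.
Variable R : realType.

(* [v w] is the basis vector of weight [w]; it is 0 unless [w] is one of
   6, 4, ..., -6, so that [v 8 = v (-8) = 0]. *)
Definition v (w : int) : V6 R := \row_(i < 7) (w == 6 - 2 * i%:Z)%:R.

Definition lin_ext (f : 'I_7 -> V6 R) (x : V6 R) : V6 R :=
  \sum_i x 0 i *: f i.

Definition actH : V6 R -> V6 R :=
  lin_ext (fun i => (6 - 2 * i%:Z)%:~R *: v (6 - 2 * i%:Z)).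
Definition actE : V6 R -> V6 R :=
  lin_ext (fun i => (7 - i%:Z)%:~R *: v (6 - 2 * (i%:Z - 1))).
Definition actF : V6 R -> V6 R :=
  lin_ext (fun i => (i%:Z + 1)%:~R *: v (6 - 2 * (i%:Z + 1))).

(* A linear map from the exterior square is an alternating bilinear map, and
   g acts on it by g.(x /\ y) = g.x /\ y + x /\ g.y. *)
Definition alternating (alpha : V6 R -> V6 R -> V6 R) : Prop :=
  forall x, alpha x x = 0.

Definition commutes_with (g : V6 R -> V6 R) (alpha : V6 R -> V6 R -> V6 R) :
    Prop :=
  forall x y, g (alpha x y) = alpha (g x) y + alpha x (g y).

Definition sl2_morphism (alpha : V6 R -> V6 R -> V6 R) : Prop :=
  [/\ commutes_with actH alpha, commutes_with actE alpha
    & commutes_with actF alpha].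

Definition structure_constants (alpha : V6 R -> V6 R -> V6 R) : Prop :=
  [/\ [/\ alpha (v 6) (v 4) = 0,
          alpha (v 6) (v 2) = 0,
          alpha (v 6) (v 0) = 20 *: v 6,
          alpha (v 6) (v (-2)) = 10 *: v 4 &
          alpha (v 6) (v (-4)) = 4 *: v 2 /\ alpha (v 6) (v (-6)) = v 0],
      [/\ alpha (v 4) (v 2) = (- 60) *: v 6,
          alpha (v 4) (v 0) = (- 20) *: v 4,
          alpha (v 4) (v (-2)) = 0,
          alpha (v 4) (v (-4)) = 6 *: v 0 &
          alpha (v 4) (v (-6)) = 4 *: v (-2)],
      [/\ alpha (v 2) (v 0) = (- 20) *: v 2,
          alpha (v 2) (v (-2)) = (- 15) *: v 0,
          alpha (v 2) (v (-4)) = 0 &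
          alpha (v 2) (v (-6)) = 10 *: v (-4)],
      [/\ alpha (v 0) (v (-2)) = (- 20) *: v (-2),
          alpha (v 0) (v (-4)) = (- 20) *: v (-4) &
          alpha (v 0) (v (-6)) = 20 *: v (-6)] &
      [/\ alpha (v (-2)) (v (-4)) = (- 60) *: v (-6),
          alpha (v (-2)) (v (-6)) = 0 &
          alpha (v (-4)) (v (-6)) = 0]].

Definition normalized_morphism (alpha : V6 R -> V6 R -> V6 R) : Prop :=
  [/\ alternating alpha, sl2_morphism alpha & structure_constants alpha].

(* The remaining lemmas show that H, E, F define an sl2-module structure and
   that a normalized morphism exists. *)
Definition plucker (x y : V6 R) (i j : nat) : R[i] :=
  x 0 (inord i) * y 0 (inord j) - x 0 (inord j) * y 0 (inord i).

Definition bracket (x y : V6 R) : V6 R :=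
  \row_(k < 7) [:: 20 * plucker x y 0 3 - 60 * plucker x y 1 2;
                   10 * plucker x y 0 4 - 20 * plucker x y 1 3;
                   4 * plucker x y 0 5 - 20 * plucker x y 2 3;
                   plucker x y 0 6 + 6 * plucker x y 1 5 - 15 * plucker x y 2 4;
                   4 * plucker x y 1 6 - 20 * plucker x y 3 4;
                   10 * plucker x y 2 6 - 20 * plucker x y 3 5;
                   20 * plucker x y 3 6 - 60 * plucker x y 4 5]`_k.

Lemma bracket_is_bilinear : bilinear_for *:%R *:%R bracket.
Proof.
split=> [y a x x'|x a y y'] /=; apply/rowP=> -[[|[|[|[|[|[|[|//]]]]]]] lt_k7];
  rewrite !mxE /= /plucker !mxE; ring.
Qed.

HB.instance Definition _ :=
  bilinear_isBilinear.Build _ _ _ _ _ _ bracket bracket_is_bilinear.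

Lemma sum7E (G : 'I_7 -> R[i]) :
  \sum_i G i = G (inord 0) + G (inord 1) + G (inord 2) + G (inord 3)
              + G (inord 4) + G (inord 5) + G (inord 6).
Proof.
rewrite !big_ord_recl big_ord0 !addrA addr0.
by do ![congr (_ + _)]; congr (G _); apply/val_inj; rewrite /= inordK.
Qed.

Lemma lin_extE f (x : V6 R) k : lin_ext f x 0 k = \sum_i x 0 i * f i 0 k.
Proof. by rewrite summxE; apply: eq_bigr => i _; rewrite mxE. Qed.

Lemma eq_inord7 (P : 'I_7 -> Prop) :
  P (inord 0) -> P (inord 1) -> P (inord 2) -> P (inord 3) -> P (inord 4) ->
  P (inord 5) -> P (inord 6) -> forall k, P k.
Proof.
move=> P0 P1 P2 P3 P4 P5 P6 k; rewrite -[k]inord_val.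
by case: k => -[|[|[|[|[|[|[|//]]]]]]].
Qed.

Lemma vE (i : int) (k : 'I_7) : v (6 - 2 * i) 0 k = (i == k%:Z)%:R.
Proof. by rewrite mxE; congr (nat_of_bool _)%:R; apply/eqP/eqP; lia. Qed.

Lemma actionE (c w : 'I_7 -> int) x k :
  lin_ext (fun i => (c i)%:~R *: v (6 - 2 * w i)) x 0 k =
  \sum_i x 0 i * ((c i)%:~R * (w i == k%:Z)%:R).
Proof. by rewrite lin_extE; apply: eq_bigr => i _; rewrite mxE vE. Qed.

Lemma actHE x : actH x = \row_(k < 7)
  [:: 6 * x 0 (inord 0); 4 * x 0 (inord 1); 2 * x 0 (inord 2); 0;
      - 2 * x 0 (inord 4); - 4 * x 0 (inord 5); - 6 * x 0 (inord 6)]`_k.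
Proof.
apply/rowP; apply: eq_inord7; rewrite actionE sum7E !mxE !inordK //=; ring.
Qed.

Lemma actEE x : actE x = \row_(k < 7)
  [:: 6 * x 0 (inord 1); 5 * x 0 (inord 2); 4 * x 0 (inord 3);
      3 * x 0 (inord 4); 2 * x 0 (inord 5); x 0 (inord 6); 0]`_k.
Proof.
apply/rowP; apply: eq_inord7; rewrite actionE sum7E !mxE !inordK //=; ring.
Qed.

Lemma actFE x : actF x = \row_(k < 7)
  [:: 0; x 0 (inord 0); 2 * x 0 (inord 1); 3 * x 0 (inord 2);
      4 * x 0 (inord 3); 5 * x 0 (inord 4); 6 * x 0 (inord 5)]`_k.
Proof.
apply/rowP; apply: eq_inord7; rewrite actionE sum7E !mxE !inordK //=; ring.
Qed.

Lemma sl2_relations x :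
  [/\ actH (actE x) - actE (actH x) = 2 *: actE x,
      actH (actF x) - actF (actH x) = - 2 *: actF x &
      actE (actF x) - actF (actE x) = actH x].
Proof.
split; apply/rowP; apply: eq_inord7;
  rewrite !(actHE, actEE, actFE) !mxE !inordK //= ?mxE ?inordK //=; ring.
Qed.

Lemma v_delta (w : int) (i : nat) :
  w = 6 - 2 * i%:Z -> v w = \row_(k < 7) (i == k)%:R.
Proof. by move=> ->; apply/rowP => k; rewrite vE mxE. Qed.

Lemma bracket_structure_constants : structure_constants bracket.
Proof.
rewrite /structure_constants (@v_delta 6 0) // (@v_delta 4 1) //.
rewrite (@v_delta 2 2) // (@v_delta 0 3) // (@v_delta (- 2) 4) //.
rewrite (@v_delta (- 4) 5) // (@v_delta (- 6) 6) //.
by do ![split]; apply/rowP; apply: eq_inord7;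
  rewrite !mxE !inordK //= /plucker ?mxE ?inordK //=; ring.
Qed.

Lemma normalized_morphism_exists :
  exists alpha : {bilinear V6 R -> V6 R -> V6 R}, normalized_morphism alpha.
Proof.
exists bracket; split; last exact: bracket_structure_constants.
- by move=> x; apply/rowP; apply: eq_inord7; rewrite !mxE inordK //= /plucker;
    ring.
- by split=> x y; apply/rowP; apply: eq_inord7;
    rewrite !(actHE, actEE, actFE) !mxE !inordK //= /plucker ?mxE ?inordK //=;
    ring.
Qed.

End V6.

(* Main.v *)
From HB Require Import structures.
Require Import Defs.
From mathcomp Require Import all_boot all_order all_algebra.
From mathcomp Require Import finmap zify ring reals complex monalg.

Set Implicit Arguments.
Unset Strict Implicit.
Unset Printing Implicit Defensive.

Import GRing.Theory Num.Theory.
Local Open Scope ring_scope.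

(** Why the theorem is true.

    Fix a degree n <= 5 and work in the multilinear part, on letters
    x_0, ..., x_{n-1}, of the free algebra of the variety defined by
    anticommutativity, the Malcev identity and k.  It is an S_n-module, and
    the left-normed monomials span it: it is a quotient of the group algebra.
    By Maschke's theorem the quotient map splits, and an equivariant section
    has the form m |-> sum_r phi(m^r) r^-1, where m^r is m with its letters
    permuted by r and phi is a single linear form on the module.  This yields a
    reproducing formula

      D m = sum_r phi(m^r) [[x_{r^-1(0)}, x_{r^-1(1)}], x_{r^-1(2)}] ...

    in every algebra of the variety, in the spirit of the formula of Dynkin,
    Specht and Wever for Lie polynomials.  The dimension of the module for
    n = 1, ..., 5 is 1, 1, 3, 10, 34, and this is also the rank of the
    evaluations of multilinear monomials on V(6).  So phi can be chosen as a
    combination of evaluations on V(6): substitute basis vectors for the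
    letters and take the coefficient of the result.  The lists [probes] give
    such forms; the formula is [projection_formula].

    The formula transfers identities ([transfer_identity]).  Let p vanish on
    V(6) and expand the degree n part of p in an algebra of the variety by the
    formula.  Collect the terms with the same left-normed product: its
    coefficient is phi applied to a multilinear polarization of p.
    Polarizations of p vanish on V(6), as the ground field has characteristic
    zero ([polarization]), and phi only sees values on V(6), so every
    coefficient is zero.

    By equivariance, and as the letters of the formula may be specialised, it
    is enough to prove it for the binary trees with leaves x_0, ..., x_{n-1}
    in this order.  For such a tree the difference of the two sides is an
    explicit integer combination of substitution instances of the Malcev
    identity and of k, listed in [certificate]; only anticommutativity is left
    to apply, which [residues_vanish_le5] does by computation with integers.
    These integers stay small because V(6) is evaluated in a rescaled basis
    whose structure constants are 0, 1, -1, 2 and -2 ([alpha_basis]). *)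

(** * Trees, their leaves and the words on them *)

Fixpoint leaves (m : magma) : seq nat :=
  match m with Var i => [:: i] | Mul a b => leaves a ++ leaves b end.

(** Keeps the shape of [m] and writes the word [r] on its leaves, from left to
    right.  A monomial is thus a shape together with the word [leaves m]. *)
Fixpoint fill (m : magma) (r : seq nat) : magma :=
  match m with
  | Var _ => Var (head 0%N r)
  | Mul a b => Mul (fill a (take (mon_deg a) r)) (fill b (drop (mon_deg a) r))
  end.

Fixpoint relabel (f : nat -> nat) (m : magma) : magma :=
  match m with
  | Var i => Var (f i)
  | Mul a b => Mul (relabel f a) (relabel f b)
  end.

Lemma size_leaves m : size (leaves m) = mon_deg m.
Proof. by elim: m => //= a IHa b IHb; rewrite size_cat IHa IHb. Qed.

Lemma mon_deg_gt0 m : (0 < mon_deg m)%N.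
Proof. by elim: m => //= a IHa b _; rewrite addn_gt0 IHa. Qed.

Lemma fill_leaves m : fill m (leaves m) = m.
Proof.
elim: m => //= a IHa b IHb.
by rewrite -size_leaves take_size_cat // drop_size_cat // IHa IHb.
Qed.

Lemma leaves_fill m r : size r = mon_deg m -> leaves (fill m r) = r.
Proof.
elim: m r => [i|a IHa b IHb] r /=; first by case: r => [|j []].
move=> szr; rewrite IHa ?IHb ?cat_take_drop //.
  by rewrite size_drop szr addKn.
by rewrite size_takel // szr leq_addr.
Qed.

Lemma relabel_fill f m r :
  size r = mon_deg m -> relabel f (fill m r) = fill m (map f r).
Proof.
elim: m r => [i|a IHa b IHb] r /=; first by case: r => [|j []].
move=> szr; rewrite -map_take -map_drop IHa ?IHb //.
  by rewrite size_drop szr addKn.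
by rewrite size_takel // szr leq_addr.
Qed.

Lemma mon_eval_relabel (A : Type) (mul : A -> A -> A) s f m :
  mon_eval mul s (relabel f m) = mon_eval mul (s \o f) m.
Proof. by elim: m => //= a -> b ->. Qed.

Lemma mon_deg_fill m r : mon_deg (fill m r) = mon_deg m.
Proof. by elim: m r => //= a IHa b IHb r; rewrite IHa IHb. Qed.

Lemma fill_fill m q r : fill (fill m q) r = fill m r.
Proof. by elim: m q r => //= a IHa b IHb q r; rewrite mon_deg_fill IHa IHb. Qed.

(** The words obtained from [w] by replacing each letter [v] by some element of
    [J v]: they index the expansion of a product of sums. *)
Fixpoint choices (J : nat -> seq nat) (w : seq nat) : seq (seq nat) :=
  if w is v :: w' then [seq j :: r | j <- J v, r <- choices J w']
  else [:: [::]].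

Lemma mem_choices s w r :
  (r \in choices (fun=> s) w) = (size r == size w) && all (mem s) r.
Proof.
elim: w r => [|v w IHw] r; first by rewrite inE; case: r.
apply/allpairsP/idP => [[[j q] /= [sj]]|].
  by rewrite IHw => /andP[/eqP szq sq] ->; rewrite /= szq sj sq eqxx.
case: r => // j q /=; rewrite eqSS => /andP[szq /andP[sj sq]].
by exists (j, q); rewrite /= IHw szq.
Qed.

Lemma choices_uniq s w : uniq s -> uniq (choices (fun=> s) w).
Proof.
move=> Us; elim: w => //= v w IHw.
by apply: allpairs_uniq => // -[i q] [j r] _ _ [-> ->].
Qed.

Lemma size_choices J w r : r \in choices J w -> size r = size w.
Proof.
elim: w r => [|v w IHw] r; first by rewrite inE => /eqP->.
by case/allpairsP => -[j q] [/= _ /IHw <- ->].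
Qed.

Lemma choices_sub J (s : seq nat) w r :
  (forall v, {subset J v <= s}) -> r \in choices J w -> {subset r <= s}.
Proof.
move=> sJ; elim: w r => [|v w IHw] r; first by rewrite inE => /eqP->.
case/allpairsP => -[j q] [/= /sJ sj /IHw sq ->] k.
by rewrite inE => /predU1P[->//|/sq].
Qed.

Section Sums.
Variable V : nmodType.

Lemma sum_choices_cat J w1 w2 (F : seq nat -> V) :
  \sum_(r <- choices J (w1 ++ w2)) F r =
  \sum_(r1 <- choices J w1) \sum_(r2 <- choices J w2) F (r1 ++ r2).
Proof.
elim: w1 F => [|v w IHw] F /=; first by rewrite big_seq1.
rewrite !big_allpairs_dep; apply: eq_bigr => j _.
exact: (IHw (fun r => F (j :: r))).
Qed.

(** When [J v] is the set of places of [s] where the word [u] has the letter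
    [v], the choices along [w] are the words of places which [u] reads as
    [w]. *)
Lemma sum_choices_filter (s u w : seq nat) (F : seq nat -> V) :
  \sum_(r <- choices (fun v => [seq j <- s | nth 0%N u j == v]) w) F r =
  \sum_(r <- choices (fun=> s) w | map (nth 0%N u) r == w) F r.
Proof.
elim: w F => [|v w IHw] F /=; first by rewrite !big_cons !big_nil.
rewrite [RHS]big_mkcond !big_allpairs_dep big_filter big_mkcond.
apply: eq_bigr => j _ /=; rewrite (IHw (fun r => F (j :: r))) big_mkcond.
case: eqP => [uj|/eqP/negbTE uj].
  by apply: eq_bigr => r _; rewrite eqseq_cons uj eqxx.
by rewrite big1 // => r _; rewrite eqseq_cons uj.
Qed.

(** Grouping a sum by the values of a key, for a type of keys which need not be
    finite. *)
Lemma sum_fibers (I J : eqType) (X : seq I) (key : I -> J) (F : I -> V) :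
  \sum_(x <- X) F x =
  \sum_(u <- undup (map key X)) \sum_(x <- X | key x == u) F x.
Proof.
under [RHS]eq_bigr do rewrite big_mkcond.
rewrite exchange_big; apply: eq_big_seq => x Xx /=.
rewrite -big_mkcond -big_filter (eq_filter (a2 := pred1 (key x))) => [|u].
  by rewrite filter_pred1_uniq ?undup_uniq ?mem_undup ?map_f ?big_seq1.
exact: eq_sym.
Qed.

End Sums.

(** * Polarization of identities *)

Section Bilinear.
Variables (K : comNzRingType) (V : lmodType K) (mul : {bilinear V -> V -> V}).

Lemma mon_eval_sum (J : nat -> seq nat) x m :
  mon_eval mul (fun v => \sum_(j <- J v) x j) m =
  \sum_(r <- choices J (leaves m)) mon_eval mul x (fill m r).
Proof.
elim: m => [i|a IHa b IHb].
  rewrite -[leaves _]/[:: i].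
  rewrite -[choices J _]/[seq j :: r | j <- J i, r <- [:: [::]]].
  by rewrite big_allpairs_dep; apply: eq_bigr => j _; rewrite big_seq1.
rewrite /= IHa IHb linear_sumlz sum_choices_cat.
apply: eq_big_seq => r1 /size_choices; rewrite size_leaves => sz1.
rewrite linear_sumr; apply: eq_bigr => r2 _.
by rewrite -sz1 take_size_cat // drop_size_cat.
Qed.

Lemma mon_eval_scale (c : nat -> K) x m :
  mon_eval mul (fun j => c j *: x j) m =
  (\prod_(j <- leaves m) c j) *: mon_eval mul x m.
Proof.
elim: m => [i|a IHa b IHb] /=; first by rewrite big_seq1.
by rewrite IHa IHb linearZl_LR linearZr_LR /= scalerA big_cat.
Qed.

End Bilinear.

Section Polarization.
Variables (K : numFieldType) (V : lmodType K).

(** If q(t) is the sum of the t^k q_k, then q(2t) - 2^n q(t) has no term of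
    degree n and has the coefficients (2^k - 2^n) q_k below: the induction on
    the degree needs only that 2^k <> 2^n. *)
Lemma vanishing_polynomial n (q : nat -> V) :
  (forall t : K, \sum_(k < n) t ^+ k *: q k = 0) ->
  forall k, (k < n)%N -> q k = 0.
Proof.
elim: n q => // n IHn q q0.
have lt_q0 k : (k < n)%N -> q k = 0.
  move=> lt_kn; suff /eqP: (2 ^+ k - 2 ^+ n) *: q k = 0 :> V.
    rewrite scaler_eq0 subr_eq0 -!natrX eqr_nat eqn_exp2l // (ltn_eqF lt_kn).
    by move/eqP.
  apply: (IHn (fun k => (2 ^+ k - 2 ^+ n) *: q k)) lt_kn => t.
  pose S t' := \sum_(k < n) t' ^+ k *: q k.
  have SE t' : S t' = - (t' ^+ n *: q n).
    by apply/eqP; rewrite -addr_eq0 -(q0 t') big_ord_recr.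
  have -> : \sum_(k < n) t ^+ k *: ((2 ^+ k - 2 ^+ n) *: q k) =
            S (2 * t) - 2 ^+ n *: S t.
    rewrite scaler_sumr -sumrB; apply: eq_bigr => i _.
    by rewrite !scalerA -scalerBl exprMn; congr (_ *: _); ring.
  by rewrite !SE scalerN opprK scalerA exprMn addNr.
move=> k; rewrite ltnS leq_eqVlt => /predU1P[->|]; last exact: lt_q0.
have := q0 1; rewrite big_ord_recr /= expr1n scale1r big1 ?add0r // => i _.
by rewrite lt_q0 ?scaler0.
Qed.

Lemma vanishing_component (I : eqType) (X : seq I) (d : I -> nat) (F : I -> V) :
  (forall t : K, \sum_(i <- X) t ^+ d i *: F i = 0) ->
  forall k, \sum_(i <- X | d i == k) F i = 0.
Proof.
move=> F0 k; pose N := (k + \max_(i <- X) d i).+1.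
pose q k := \sum_(i <- X | d i == k) F i.
apply: (@vanishing_polynomial N q); last by rewrite ltnS leq_addr.
move=> t; rewrite -[RHS](F0 t) /q.
under eq_bigr do rewrite scaler_sumr big_mkcond.
rewrite exchange_big; apply: eq_big_seq => i Xi /=.
have ltiN : (d i < N)%N.
  by rewrite ltnS (leq_trans _ (leq_addl _ _)) // leq_bigmax_seq.
by rewrite -big_mkcond (big_pred1 (Ordinal ltiN)) //= => j; rewrite eq_sym.
Qed.

Variable mul : {bilinear V -> V -> V}.

(** The terms which are linear in each of the letters of [L] vanish together:
    rescaling one letter makes the sum a polynomial in the scaling factor, of
    which they are the coefficient of degree one. *)
Lemma multilinear_part (I : eqType) (X : seq I) (c : I -> K) (m : I -> magma) :
  (forall x, \sum_(i <- X) c i *: mon_eval mul x (m i) = 0) ->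
  forall L x, \sum_(i <- X | all (fun j => count_mem j (leaves (m i)) == 1%N) L)
                c i *: mon_eval mul x (m i) = 0.
Proof.
move=> X0; elim=> [|j L IHL] x /=; first exact: X0.
under eq_bigl do rewrite andbC.
rewrite -big_filter_cond; apply: vanishing_component => t.
rewrite big_filter -[RHS](IHL (fun i => (if i == j then t else 1) *: x i)).
apply: eq_bigr => i _; rewrite mon_eval_scale !scalerA mulrC.
congr (_ * _ *: _).
by rewrite -big_mkcond big_const_seq iter_mulr_1.
Qed.

Variable p : napoly K.
Hypothesis p0 : satisfies mul p.

(** Polarization along a word [u] of length [n].  Substitute for each variable
    [v] the sum of the [x j] over the places [j] of [u] where it occurs, and
    keep the part linear in each of [x 0], ..., [x n.-1].  Only monomials of
    degree [n] contribute to it, each with all the ways to number its leaves by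
    places where [u] has the right letter. *)
Lemma polarization n (u : seq nat) x :
  \sum_(m <- msupp p | mon_deg m == n) p@_m *:
    \sum_(r <- permutations (iota 0 n) | map (nth 0%N u) r == leaves m)
      mon_eval mul x (fill m r) = 0.
Proof.
pose J v := [seq j <- iota 0 n | nth 0%N u j == v].
pose X := [seq (m, r) | m <- msupp p, r <- choices J (leaves m)].
have X0 y : \sum_(mr <- X) p@_mr.1 *: mon_eval mul y (fill mr.1 mr.2) = 0.
  rewrite -[RHS](p0 (fun v => \sum_(j <- J v) y j)) /na_eval big_allpairs_dep.
  by apply: eq_bigr => m _; rewrite mon_eval_sum scaler_sumr.
rewrite -[RHS](multilinear_part X0 (iota 0 n) x) [RHS]big_mkcond.
rewrite big_allpairs_dep.
rewrite [LHS]big_mkcond; apply: eq_bigr => m _ /=.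
(* A word in the places 0, ..., n-1 that takes each of them once is a
   permutation of them. *)
pose G r :=
  if perm_eq r (iota 0 n) then p@_m *: mon_eval mul x (fill m r) else 0.
transitivity (\sum_(r <- choices J (leaves m)) G r); last first.
  apply: eq_big_seq => r Jr; rewrite /G; congr (if _ then _ else _).
  rewrite leaves_fill -?size_leaves ?(size_choices Jr) //.
  have one j : j \in iota 0 n -> count_mem j (iota 0 n) = 1%N.
    by move=> nj; rewrite count_uniq_mem ?iota_uniq // nj.
  apply/idP/allP => [/permP eq_r j nj|r1]; first by rewrite eq_r one.
  have sr : {subset r <= iota 0 n}.
    by apply: choices_sub Jr => v j; rewrite mem_filter => /andP[].
  apply/allP => j; rewrite mem_cat => rj.
  have nj : j \in iota 0 n by case/orP: rj => // /sr.
  by rewrite /= one ?r1.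
rewrite sum_choices_filter /G -big_mkcondr.
case: eqP => [degm|degm]; last first.
  rewrite big_seq_cond big1 // => r /and3P[/size_choices szr _ /perm_size].
  by rewrite szr size_leaves size_iota.
rewrite scaler_sumr -[LHS]big_filter -[RHS]big_filter; apply: perm_big.
apply: uniq_perm; rewrite ?filter_uniq ?permutations_uniq ?choices_uniq //.
  exact: iota_uniq.
move=> r; rewrite !mem_filter mem_permutations mem_choices andbC -andbA.
case: eqP => //= _; case: (boolP (perm_eq _ _)) => //= perm_r.
rewrite (perm_size perm_r) size_iota size_leaves degm eqxx /=.
by rewrite (perm_all _ perm_r); apply/esym/allP.
Qed.

End Polarization.

(** * Integer combinations of monomials *)

Definition lin := seq (int * magma).

Definition malcev_terms (a b c d : magma) : lin :=
  [:: (1, ((a * c) * b) * d); (1, ((d * a) * c) * b); (1, ((c * b) * d) * a);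
      (1, ((b * d) * a) * c); (-1, (a * b) * (c * d))]%mag.

Definition k_terms (a b c d e : magma) : lin :=
  [:: (-1, (((a * b) * c) * e) * d); (1, (((a * b) * e) * d) * c);
      (1, (((a * c) * b) * d) * e); (-1, (((a * c) * d) * e) * b);
      (-1, (((a * d) * b) * c) * e); (-1, (((a * d) * c) * b) * e);
      (1, (((a * e) * b) * c) * d); (1, (((a * e) * c) * b) * d);
      (1, (((b * d) * c) * a) * e); (-1, (((b * e) * a) * d) * c);
      (1, (((b * e) * c) * d) * a); (-1, (((b * e) * d) * a) * c);
      (1, (((c * d) * a) * e) * b); (-1, (((c * d) * b) * e) * a);
      (1, (((c * d) * e) * a) * b); (-1, (((c * e) * b) * a) * d);
      (1, ((a * b) * c) * (d * e)); (1, ((a * c) * b) * (d * e))]%mag.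

(** Substitution instances of the two identities, and right multiples of those
    of the Malcev identity; with anticommutativity they span the consequences
    in degree at most five. *)
Inductive relator :=
  | Malcev of magma & magma & magma & magma
  | MalcevMul of magma & magma & magma & magma & magma
  | KId of magma & magma & magma & magma & magma.

Definition relator_terms (q : relator) : lin :=
  match q with
  | Malcev a b c d => malcev_terms a b c d
  | MalcevMul a b c d e => [seq (t.1, t.2 * e)%mag | t <- malcev_terms a b c d]
  | KId a b c d e => k_terms a b c d e
  end.

Definition scale (c : int) (l : lin) : lin := [seq (c * t.1, t.2) | t <- l].

Definition head_leaf m := head 0%N (leaves m).

(** In a multilinear monomial two subtrees of equal degree have different first
    leaves, so this orders the factors of every product. *)
Definition heavier a b :=
  (mon_deg b < mon_deg a)%N ||
  (mon_deg a == mon_deg b) && (head_leaf a <= head_leaf b)%N.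

(** Normal form for anticommutativity with its sign: the heavier factor comes
    first, so that the tree has one of the few shapes read by [certificate]. *)
Fixpoint canon (m : magma) : int * magma :=
  match m with
  | Var i => (1, Var i)
  | Mul a b =>
      let: (c, a') := canon a in let: (d, b') := canon b in
      if heavier a' b' then (c * d, Mul a' b') else (- (c * d), Mul b' a')
  end.

Fixpoint eqmag (m m' : magma) : bool :=
  match m, m' with
  | Var i, Var j => i == j
  | Mul a b, Mul a' b' => eqmag a a' && eqmag b b'
  | _, _ => false
  end.

Fixpoint add_term (c : int) (m : magma) (l : lin) : lin :=
  if l is (d, m') :: l' then
    if eqmag m m' then (c + d, m') :: l' else (d, m') :: add_term c m l'
  else [:: (c, m)].

Definition collect (l : lin) : lin :=
  foldr (fun t acc => let: (d, m) := canon t.2 in add_term (t.1 * d) m acc)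
    [::] l.

Definition vanishes (l : lin) : bool := all (fun t => t.1 == 0) (collect l).

(** * V(6) in a basis with small structure constants *)

Inductive basis := H | A1 | A2 | A3 | B1 | B2 | B3.

(** Up to scaling these are the vector matrices of Zorn for the split octonions
    of trace zero: [H] is the diagonal one, the [A]'s and the [B]'s are the two
    off-diagonal triples, which multiply by cross products. *)
Definition half_mul (x y : basis) : int * basis :=
  match x, y with
  | H, A1 => (1, A1) | H, A2 => (1, A2) | H, A3 => (1, A3)
  | H, B1 => (-1, B1) | H, B2 => (-1, B2) | H, B3 => (-1, B3)
  | B1, A1 | B2, A2 | B3, A3 => (1, H)
  | A1, A2 => (1, B3) | A2, A3 => (1, B1) | A3, A1 => (1, B2)
  | B1, B2 => (2, A3) | B2, B3 => (2, A1) | B3, B1 => (2, A2)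
  | _, _ => (0, H)
  end.

Definition basis_mul (x y : basis) : int * basis :=
  let: (c, z) := half_mul x y in
  if c == 0 then let: (d, z) := half_mul y x in (- d, z) else (c, z).

(** A product of basis vectors is a multiple of a basis vector, so a monomial
    evaluates to a coefficient and a basis vector. *)
Fixpoint basis_eval (g : nat -> basis) (m : magma) : int * basis :=
  match m with
  | Var i => (1, g i)
  | Mul a b =>
      let: (c, x) := basis_eval g a in let: (d, y) := basis_eval g b in
      let: (e, z) := basis_mul x y in (c * d * e, z)
  end.

(** The linear form phi of degree [n] is a combination of the evaluations which
    send the letters to these basis vectors.  The condition that
    m |-> sum_r phi(m^r) r^-1 is a section amounts to a small linear system for
    its coefficients (of rank 1, 1, 2, 6, 12 for n = 1, ..., 5); this is a
    solution with few non-zero entries, cleared of denominators by [denom]. *)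
Definition probes (n : nat) : seq (int * seq basis) :=
  match n with
  | 1 => [:: (1, [:: H])]
  | 2 => [:: (1, [:: H; A1])]
  | 3 => [:: (1, [:: H; A1; A2]); (-2, [:: H; A1; H])]
  | 4 => [:: (3, [:: H; A1; H; H]); (4, [:: A1; A2; A3; A1]);
             (8, [:: H; A1; H; B1]); (-2, [:: A1; B2; A2; H])]
  | 5 => [:: (14, [:: H; A1; H; A1; B1]); (-22, [:: H; A1; H; H; B1]);
             (-20, [:: A1; B1; A1; A2; B1]); (-5, [:: A1; A2; A3; H; A1]);
             (-10, [:: H; A1; B1; H; A2]); (-5, [:: A1; A2; H; A3; B1]);
             (-35, [:: A1; A2; A3; A3; H])]
  | _ => [::]
  end.

Definition denom (n : nat) : int :=
  match n with 1 => 1 | 2 => 2 | 3 => 6 | 4 => 36 | _ => 360 end.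

(** * The reproducing formula on ordered trees *)

Definition phi n m : int :=
  foldr (fun g acc => g.1 * (basis_eval (nth H g.2) m).1 + acc) 0 (probes n).

Definition left_normed (w : seq nat) : magma :=
  if w is i :: w' then foldl (fun m j => Mul m (Var j)) (Var i) w' else Var 0.

(** Moves the letter of [w] at [i] to the place given by [r] at [i]: this is the
    word w o r^-1 when [r] is a permutation of the places. *)
Definition place (w r : seq nat) : seq nat :=
  [seq nth 0%N w (index j r) | j <- iota 0 (size r)].

Definition projection n t : lin :=
  [seq (phi n (fill t r), left_normed (place (iota 0 n) r))
  | r <- permutations (iota 0 n)].

(** The coefficients with which the relators give, modulo anticommutativity, the
    difference of the two sides of the reproducing formula for a tree in normal
    form.  They solve a linear system over the rationals in the span of the
    anticommutative monomials (15 of them in degree four, 105 in degree five);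
    in degree at most three both sides agree by anticommutativity alone. *)
Definition certificate (t : magma) : seq (int * relator) :=
  let M a b c d e :=
    MalcevMul (Var a) (Var b) (Var c) (Var d) (Var e) in
  let A a b c d e :=
    Malcev (Var a * Var b)%mag (Var c) (Var d) (Var e) in
  let K a b c d e := KId (Var a) (Var b) (Var c) (Var d) (Var e) in
  let N a b c d := Malcev (Var a) (Var b) (Var c) (Var d) in
  match t with
  | ((Var a * Var b) * Var c) * Var d =>
      [:: (3, N a b c d); (3, N a b d c); (6, N a c b d); (6, N a c d b)]
  | (Var a * Var b) * (Var c * Var d) =>
      [:: (-18, N a b c d); (18, N a b d c)]
  | (((Var a * Var b) * Var c) * Var d) * Var e =>
      [:: (-43, M a b c d e); (-41, M a b d c e); (-14, M a b d e c);
          (-16, M a b e d c); (24, M a c b e d); (-8, M a c d e b);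
          (-5, M a c e b d); (-44, M a c e d b); (-84, M a d b c e);
          (-30, M a d b e c); (-66, M a d c b e); (-57, M a d e b c);
          (-22, M a e b c d); (-6, M a e c b d); (-60, M a e c d b);
          (-24, M a e d c b); (8, M b c d e a); (46, M b c e d a);
          (62, M b e c d a); (24, M b e d c a); (-36, A a c d b e);
          (-36, A a e d b c); (-16, A b c a d e); (-18, A b c a e d);
          (38, A b c d a e); (27, A b e a c d); (29, A b e a d c);
          (38, A b e d a c); (2, A c d b e a); (-2, A d e b c a);
          (-9, K a c d b e); (54, K a d e c b); (-31, K b c d e a);
          (-14, K b d e a c); (15, K c a b d e); (15, K c a b e d);
          (-7, K c b d a e); (5, K d b c e a); (50, K d b e c a);
          (-35, K e b d a c); (17, K e b d c a)]
  | ((Var a * Var b) * (Var c * Var d)) * Var e =>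
      [:: (-180, M a b c d e); (21, M a b c e d); (180, M a b d c e);
          (-21, M a b d e c); (-89, M a b e c d); (-21, M a b e d c);
          (-68, M a c b e d); (-21, M a c d e b); (-68, M a c e b d);
          (-21, M a c e d b); (68, M a d b e c); (21, M a d c e b);
          (-42, M a d e b c); (-89, M a d e c b); (68, M b d c e a);
          (68, M b d e c a); (-21, M b e c d a); (89, M b e d c a);
          (110, A a b e d c); (110, A a d e b c); (110, A a d e c b);
          (110, A c d e a b); (110, K a b e d c); (-20, K b a e c d);
          (-20, K b a e d c); (30, K b c e d a); (-90, K c b e a d);
          (-60, K c b e d a); (-70, K d c e a b); (40, K d c e b a);
          (-80, K e b c d a)]
  | ((Var a * Var b) * Var c) * (Var d * Var e) =>
      [:: (17, M a b c d e); (-48, M a b c e d); (-48, M a b d c e);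
          (-134, M a b d e c); (17, M a b e c d); (-94, M a b e d c);
          (-31, M a c b d e); (-31, M a c d b e); (-58, M a d c e b);
          (149, M a d e c b); (-31, M a e b c d); (-138, M a e b d c);
          (-31, M a e c b d); (148, M a e c d b); (-138, M a e d b c);
          (148, M b d c e a); (-58, M b e c d a); (149, M b e d c a);
          (-180, A a b c d e); (180, A a b c e d); (20, A a b d c e);
          (-20, A a b e c d); (-90, A a e b d c); (-90, A a e c d b);
          (-90, A b d a e c); (-90, A b d c e a); (-155, A c d b a e);
          (-245, A c d b e a); (52, A c d e a b); (-148, A c d e b a);
          (-155, A c e a b d); (-245, A c e a d b); (-148, A c e d a b);
          (52, A c e d b a); (85, K a b d e c); (-25, K a d e b c);
          (-25, K a d e c b); (50, K b a d c e); (-50, K b a e c d);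
          (85, K b a e d c); (-13, K d a b c e); (-25, K d a b e c);
          (38, K e a b d c)]
  | _ => [::]
  end%mag.

(** Normalizing [t] permutes its leaves and gives a sign [e]; as the formula is
    equivariant, the certificate of the normal form, written in the permuted
    leaves, serves for [t] up to this sign. *)
Definition residue n t : lin :=
  let: (e, t') := canon t in
  (denom n, t) :: scale (-1) (projection n t) ++
  flatten [seq scale (- (e * q.1)) (relator_terms q.2) | q <- certificate t'].

(** The trees of degree [k] with leaves [o], [o + 1], ... from left to right,
    for [k] at most [fuel]. *)
Fixpoint ordered_trees (fuel o k : nat) : seq magma :=
  if fuel is f.+1 then
    if k == 1%N then [:: Var o]
    else flatten [seq [seq Mul a b | a <- ordered_trees f o i,
                                     b <- ordered_trees f (o + i)%N (k - i)%N]
                 | i <- iota 1 k.-1]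
  else [::].

Definition residues_vanish n :=
  all (fun t => vanishes (residue n t)) (ordered_trees n 0 n).

(** * Transfer of identities *)

Section Transfer.
Variables (K : numFieldType) (V A : lmodType K).
Variables (mulV : {bilinear V -> V -> V}) (mulA : A -> A -> A).
Variables (p : napoly K) (p0 : satisfies mulV p).

Lemma place_eqE n u w r : perm_eq r (iota 0 n) -> size u = n -> size w = n ->
  (place w r == u) = (map (nth 0%N u) r == w).
Proof.
move=> perm_r szu szw.
have szr : size r = n by rewrite (perm_size perm_r) size_iota.
have Ur : uniq r by rewrite (perm_uniq perm_r) iota_uniq.
have ltr j : (j \in r) = (j < n)%N by rewrite (perm_mem perm_r) mem_iota.
apply/eqP/eqP => [<-|<-].
  apply: (@eq_from_nth _ 0%N) => [|i]; rewrite size_map ?szr // => lt_in.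
  rewrite (nth_map 0%N) ?szr // (nth_map 0%N) ?size_iota ?nth_iota ?szr //
    -?ltr ?mem_nth ?szr //.
  by rewrite add0n index_uniq ?szr.
apply: (@eq_from_nth _ 0%N) => [|j]; rewrite size_map size_iota ?szr //.
move=> lt_jn.
rewrite (nth_map 0%N) ?size_iota ?szr // nth_iota // add0n.
by rewrite (nth_map 0%N) ?index_mem ?ltr // nth_index ?ltr.
Qed.

(** A reproducing formula in [A] whose coefficients are values on [V] makes the
    identities of [V] hold in [A].  In the expansion of the degree [n] part of
    [p], the terms ending with [Y u] come from the pairs of a monomial and a
    numbering of its leaves which [u] reads back as the monomial; these are the
    terms of the polarization of [p] along [u]. *)
Lemma transfer_identity n (D : K) (probe : seq (K * (nat -> V)))
    (eps : {scalar V}) (s : nat -> A) (Y : seq nat -> A) :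
  D != 0 ->
  (forall m, mon_deg m = n -> D *: mon_eval mulA s m =
     \sum_(r <- permutations (iota 0 n))
       (\sum_(g <- probe) g.1 * eps (mon_eval mulV g.2 (fill m r))) *:
         Y (place (leaves m) r)) ->
  \sum_(m <- msupp p | mon_deg m == n) p@_m *: mon_eval mulA s m = 0.
Proof.
move=> D0 formula; apply/eqP.
pose phi m := \sum_(g <- probe) g.1 * eps (mon_eval mulV g.2 m).
rewrite -(inj_eq (scalerI D0)) scaler0 scaler_sumr -big_filter; apply/eqP.
pose X := [seq (m, r) | m <- [seq m <- msupp p | mon_deg m == n],
                        r <- permutations (iota 0 n)].
pose key (x : magma * seq nat) := place (leaves x.1) x.2.
transitivity (\sum_(x <- X) (p@_x.1 * phi (fill x.1 x.2)) *: Y (key x)).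
  rewrite big_allpairs_dep; apply: eq_big_seq => m.
  rewrite mem_filter => /andP[/eqP degm _].
  rewrite scalerA mulrC -scalerA formula // scaler_sumr.
  by apply: eq_bigr => r _; rewrite scalerA.
rewrite (sum_fibers _ key) big_seq big1 // => u.
rewrite mem_undup => /mapP[x Xx uE].
have szu : size u = n.
  case/allpairsP: Xx uE => -[m r] [_ /=].
  rewrite mem_permutations => /perm_size.
  by rewrite size_iota /key => szr -> ->; rewrite size_map size_iota.
transitivity ((\sum_(x <- X | key x == u) p@_x.1 * phi (fill x.1 x.2)) *: Y u).
  by rewrite scaler_suml; apply: eq_bigr => y /eqP ->.
have -> : \sum_(x <- X | key x == u) p@_x.1 * phi (fill x.1 x.2) =
  \sum_(g <- probe) g.1 * eps (\sum_(m <- msupp p | mon_deg m == n) p@_m *: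
    \sum_(r <- permutations (iota 0 n) | map (nth 0%N u) r == leaves m)
      mon_eval mulV g.2 (fill m r)).
  rewrite big_mkcond big_allpairs_dep.
  transitivity (\sum_(m <- msupp p | mon_deg m == n)
    \sum_(r <- permutations (iota 0 n) | map (nth 0%N u) r == leaves m)
      \sum_(g <- probe) p@_m * (g.1 * eps (mon_eval mulV g.2 (fill m r)))).
    rewrite big_filter; apply: eq_bigr => m /eqP degm; rewrite [RHS]big_mkcond.
    apply: eq_big_seq => r; rewrite mem_permutations => perm_r /=.
    rewrite /key /= (place_eqE perm_r szu) ?size_leaves ?degm //.
    by rewrite /phi mulr_sumr.
  under [RHS]eq_bigr do rewrite linear_sum mulr_sumr.
  rewrite [RHS]exchange_big; apply: eq_bigr => m _.
  under [RHS]eq_bigr do rewrite linearZ linear_sum /= !mulr_sumr.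
  rewrite [RHS]exchange_big; apply: eq_bigr => r _.
  by apply: eq_bigr => g _; rewrite mulrCA.
rewrite big1 ?scale0r // => g _.
by rewrite (polarization p0) linear0 mulr0.
Qed.

Lemma na_eval_by_degree N s : degree_le N p ->
  (forall n, (n <= N)%N ->
     \sum_(m <- msupp p | mon_deg m == n) p@_m *: mon_eval mulA s m = 0) ->
  na_eval mulA s p = 0.
Proof.
move=> degp p_n; rewrite /na_eval (sum_fibers _ mon_deg) big_seq big1 // => n.
by rewrite mem_undup => /mapP[m /degp degm ->]; apply: p_n.
Qed.

End Transfer.

(** * Computing with consequences of the three identities *)

Section Soundness.
Variables (K : numFieldType) (A : lmodType K) (mul : {bilinear A -> A -> A}).

Lemma na_eval_fset (s : nat -> A) (p : napoly K) (d : {fset magma}) :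
  (msupp p `<=` d)%fset ->
  na_eval mul s p = \sum_(m <- d) p@_m *: mon_eval mul s m.
Proof.
move=> le_pd; rewrite /na_eval (big_fset_incl _ le_pd) // => m _ pm.
by rewrite mcoeff_outdom // scale0r.
Qed.

Lemma na_evalD s (p q : napoly K) :
  na_eval mul s (p + q) = na_eval mul s p + na_eval mul s q.
Proof.
rewrite (na_eval_fset _ (msuppD_le p q)).
rewrite (na_eval_fset s (fsubsetUl (msupp p) (msupp q))).
rewrite (na_eval_fset s (fsubsetUr (msupp p) (msupp q))) -big_split /=.
by apply: eq_bigr => m _; rewrite mcoeffD scalerDl.
Qed.

Lemma na_evalN s (p : napoly K) : na_eval mul s (- p) = - na_eval mul s p.
Proof.
rewrite /na_eval msuppN -sumrN; apply: eq_bigr => m _.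
by rewrite mcoeffN scaleNr.
Qed.

Lemma na_eval_mon s m : na_eval mul s (mon K m) = mon_eval mul s m.
Proof.
by rewrite /na_eval /mon msuppU oner_eq0 big_seq_fset1 mcoeffUU scale1r.
Qed.

Hypothesis anticommA : satisfies mul (anticomm_id K).
Hypothesis malcevA : satisfies mul (malcev_id K).
Hypothesis kA : satisfies mul (k_id K).

Definition lin_eval (s : nat -> A) (l : lin) : A :=
  \sum_(t <- l) t.1%:~R *: mon_eval mul s t.2.

Lemma mul_antisym x y : mul x y = - mul y x.
Proof.
have := anticommA (nth 0 [:: x; y]).
rewrite /anticomm_id /anticomm na_evalD !na_eval_mon /= => /eqP.
by rewrite addr_eq0 => /eqP.
Qed.

Lemma lin_eval_cat s l l' : lin_eval s (l ++ l') = lin_eval s l + lin_eval s l'.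
Proof. by rewrite /lin_eval big_cat. Qed.

Lemma lin_eval_scale s c l : lin_eval s (scale c l) = c%:~R *: lin_eval s l.
Proof.
rewrite /lin_eval big_map scaler_sumr; apply: eq_bigr => t _.
by rewrite intrM scalerA.
Qed.

Lemma mon_eval_canon s m :
  mon_eval mul s m = (canon m).1%:~R *: mon_eval mul s (canon m).2.
Proof.
elim: m => [i|a IHa b IHb] /=; first by rewrite scale1r.
case: (canon a) IHa (canon b) IHb => c a' /= -> [d b'] /= ->.
rewrite linearZl_LR linearZr_LR /= scalerA -intrM.
by case: ifP => //= _; rewrite mul_antisym scalerN -scaleNr mulrNz.
Qed.

Lemma eqmag_eq m m' : eqmag m m' -> m = m'.
Proof.
elim: m m' => [i|a IHa b IHb] [j|a' b'] //=; first by move/eqP->.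
by case/andP => /IHa -> /IHb ->.
Qed.

Lemma lin_eval_add_term s c m l :
  lin_eval s (add_term c m l) = c%:~R *: mon_eval mul s m + lin_eval s l.
Proof.
rewrite /lin_eval; elim: l => [|[d m'] l IHl] /=.
  by rewrite big_cons.
case: ifP => [/eqmag_eq ->|_]; rewrite !big_cons /=.
  by rewrite intrD scalerDl addrA.
by rewrite IHl addrCA.
Qed.

Lemma lin_eval_collect s l : lin_eval s (collect l) = lin_eval s l.
Proof.
elim: l => [|[c m] l IHl] //=.
rewrite [RHS]/lin_eval big_cons /= mon_eval_canon.
case: (canon m) => d m' /=.
by rewrite lin_eval_add_term IHl intrM scalerA.
Qed.

Lemma vanishes_sound s l : vanishes l -> lin_eval s l = 0.
Proof.
move/allP => l0; rewrite -lin_eval_collect /lin_eval big_seq big1 // => t.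
by move/l0/eqP ->; rewrite scale0r.
Qed.

Lemma malcev_terms_sound s a b c d : lin_eval s (malcev_terms a b c d) = 0.
Proof.
pose f := mon_eval mul s.
have := malcevA (nth 0 [:: f a; f b; f c; f d]).
have := na_eval_mon (nth 0 [:: f a; f b; f c; f d]).
rewrite /malcev_id /malcev; move: (mon K) => monK monE.
rewrite !na_evalD !na_evalN !monE /= => <-.
by rewrite /lin_eval !big_cons big_nil /= !scale1r scaleN1r addr0 !addrA.
Qed.

Lemma k_terms_sound s a b c d e : lin_eval s (k_terms a b c d e) = 0.
Proof.
pose f := mon_eval mul s.
have := kA (nth 0 [:: f a; f b; f c; f d; f e]).
have := na_eval_mon (nth 0 [:: f a; f b; f c; f d; f e]).
rewrite /k_id /kpoly; move: (mon K) => monK monE.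
rewrite !na_evalD !na_evalN !monE /= => <-.
by rewrite /lin_eval !big_cons big_nil /= !scale1r !scaleN1r addr0 !addrA.
Qed.

Lemma relator_sound s q : lin_eval s (relator_terms q) = 0.
Proof.
case: q => [a b c d|a b c d e|a b c d e].
- exact: malcev_terms_sound.
- transitivity (mul (lin_eval s (malcev_terms a b c d)) (mon_eval mul s e)).
    rewrite -[relator_terms _]/
      [seq (t.1, t.2 * e)%mag | t <- malcev_terms a b c d].
    rewrite /lin_eval big_map linear_sumlz.
    by apply: eq_bigr => t _; rewrite linearZl_LR.
  by rewrite malcev_terms_sound linear0l.
- exact: k_terms_sound.
Qed.

Lemma residue_sound n s t : vanishes (residue n t) ->
  (denom n)%:~R *: mon_eval mul s t =
  \sum_(r <- permutations (iota 0 n))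
    (phi n (fill t r))%:~R *: mon_eval mul s (left_normed (place (iota 0 n) r)).
Proof.
move/(vanishes_sound s); rewrite /residue; case: (canon t) => e t'.
rewrite /lin_eval big_cons -/(lin_eval _ _) lin_eval_cat lin_eval_scale.
rewrite -[X in _ + (_ + X) = 0]/(lin_eval s _).
set Z := lin_eval s (flatten _); have -> : Z = 0.
  rewrite /Z; elim: (certificate t') => [|[c q] l IHl] /=.
    by rewrite /lin_eval big_nil.
  by rewrite lin_eval_cat lin_eval_scale relator_sound scaler0 add0r.
rewrite addr0 scaleN1r => /eqP; rewrite subr_eq0 => /eqP ->.
by rewrite /lin_eval big_map.
Qed.

End Soundness.

Lemma mem_ordered_trees m fuel o :
  (mon_deg m <= fuel)%N ->
  fill m (iota o (mon_deg m)) \in ordered_trees fuel o (mon_deg m).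
Proof.
elim: m fuel o => [i|a IHa b IHb] [|f] o //=; first by rewrite inE.
  by rewrite leqn0 addn_eq0 -leqn0 leqNgt mon_deg_gt0.
have posa := mon_deg_gt0 a; have posb := mon_deg_gt0 b => le_f.
rewrite ifN; last by lia.
apply/flatten_mapP; exists (mon_deg a); first by rewrite mem_iota; lia.
rewrite addKn iotaD take_size_cat ?size_iota // drop_size_cat ?size_iota //.
by apply: allpairs_f; [apply: IHa|apply: IHb]; lia.
Qed.

Lemma residues_vanish_le5 : all residues_vanish (iota 1 5).
Proof. by vm_compute. Qed.

Lemma relabel_left_normed f w :
  w != [::] -> relabel f (left_normed w) = left_normed (map f w).
Proof.
case: w => // i w _ /=; rewrite -[Var (f i)]/(relabel f (Var i)).
by elim: w (Var i) => //= j w IHw m; rewrite IHw.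
Qed.

Lemma map_place n w r : size w = n -> perm_eq r (iota 0 n) ->
  map (nth 0%N w) (place (iota 0 n) r) = place w r.
Proof.
move=> szw perm_r; rewrite /place -map_comp; apply/eq_in_map => j.
rewrite mem_iota /= (perm_size perm_r) size_iota add0n => lt_jn.
rewrite nth_iota ?add0n //.
rewrite -(size_iota 0 n) -(perm_size perm_r) index_mem (perm_mem perm_r).
by rewrite mem_iota.
Qed.

(** * The reproducing formula *)

Section Formula.
Variables (K : numFieldType) (A : lmodType K) (mul : {bilinear A -> A -> A}).
Hypothesis anticommA : satisfies mul (anticomm_id K).
Hypothesis malcevA : satisfies mul (malcev_id K).
Hypothesis kA : satisfies mul (k_id K).

(** The formula for the shape of [m] with leaves 0, ..., n-1, read at the values
    that [s] gives to the leaves of [m]. *)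
Lemma projection_formula n s m : (n <= 5)%N -> mon_deg m = n ->
  (denom n)%:~R *: mon_eval mul s m =
  \sum_(r <- permutations (iota 0 n))
    (phi n (fill m r))%:~R *: mon_eval mul s (left_normed (place (leaves m) r)).
Proof.
move=> le_n5 degm.
have n_gt0 : (0 < n)%N by rewrite -degm mon_deg_gt0.
have szw : size (leaves m) = n by rewrite size_leaves.
have := mem_ordered_trees 0 (leqnn (mon_deg m)); rewrite degm => tm.
have /allP/(_ _ tm) : residues_vanish n.
  by apply: (allP residues_vanish_le5); rewrite mem_iota n_gt0.
move=> /(residue_sound anticommA malcevA kA (s \o nth 0%N (leaves m))).
rewrite -mon_eval_relabel relabel_fill ?size_iota //.
have -> : map (nth 0%N (leaves m)) (iota 0 n) = leaves m.
  by rewrite -szw map_nth_iota0 ?take_size.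
rewrite fill_leaves => ->.
apply: eq_big_seq => r; rewrite mem_permutations => perm_r.
rewrite fill_fill -mon_eval_relabel relabel_left_normed ?map_place //.
by rewrite -size_eq0 size_map size_iota (perm_size perm_r) size_iota -lt0n.
Qed.

End Formula.

(** * The rescaled basis of V(6) *)

Section Octonions.
Variables (R : realType) (alpha : {bilinear V6 R -> V6 R -> V6 R}).
Hypothesis halpha : normalized_morphism alpha.

(** The scaling makes all the products in [basis_mul] hold with small integers;
    from A1 = - v_6, A2 = - v_{-2} and the action of H = - v_0 / 20, the
    others are forced by the table. *)
Definition basis_vec (b : basis) : V6 R :=
  match b with
  | H => - 20^-1 *: v R 0
  | A1 => - 1 *: v R 6
  | A2 => - 1 *: v R (-2)
  | A3 => - 1200^-1 *: v R (-4)
  | B1 => - 20^-1 *: v R (-6)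
  | B2 => - 300^-1 *: v R 2
  | B3 => 10 *: v R 4
  end.

(** The linear form with value 1 on each vector of the rescaled basis; on the
    value of a monomial at basis vectors it reads the coefficient. *)
Definition coord_sum (x : V6 R) : R[i] :=
  - x 0 (inord 0) + 10^-1 * x 0 (inord 1) - 300 * x 0 (inord 2)
  - 20 * x 0 (inord 3) - x 0 (inord 4) - 1200 * x 0 (inord 5)
  - 20 * x 0 (inord 6).

Lemma coord_sum_is_linear : scalar coord_sum.
Proof. by move=> a x y; rewrite /coord_sum !mxE; ring. Qed.

HB.instance Definition _ :=
  GRing.isLinear.Build _ _ _ _ coord_sum coord_sum_is_linear.

Lemma coord_sum_basis b : coord_sum (basis_vec b) = 1.
Proof.
case: b; rewrite /basis_vec /coord_sum ?(@v_delta R 6 0) // ?(@v_delta R 4 1) //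
  ?(@v_delta R 2 2) // ?(@v_delta R 0 3) // ?(@v_delta R (- 2) 4) //
  ?(@v_delta R (- 4) 5) // ?(@v_delta R (- 6) 6) //;
  by rewrite !mxE !inordK //=; field.
Qed.

Lemma alpha_antisym x y : alpha y x = - alpha x y.
Proof.
have [alt _ _] := halpha; apply/eqP; rewrite -addr_eq0; apply/eqP.
have := alt (x + y); rewrite linearDl !linearDr /= !alt add0r addr0 => <-.
by rewrite addrC.
Qed.

Lemma alpha_basis x y :
  alpha (basis_vec x) (basis_vec y) =
  (basis_mul x y).1%:~R *: basis_vec (basis_mul x y).2.
Proof.
have [alt _] := halpha; rewrite /structure_constants /basis_vec.
(* Only the listed products of the weight vectors matter from here on. *)
move: (v R 6) (v R 4) (v R 2) (v R 0) (v R (-2)) (v R (-4)) (v R (-6)).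
move=> v6 v4 v2 v0 w2 w4 w6 [[e1 e2 e3 e4 [e5 e6]] [f1 f2 f3 f4 f5]
  [g1 g2 g3 g4] [h1 h2 h3] [i1 i2 i3]].
have rev a b c : alpha a b = c -> alpha b a = - c.
  by move=> <-; exact: alpha_antisym.
have E := (e1, e2, e3, e4, e5, e6, (f1, f2, f3, f4, f5, g1, g2, g3, g4),
           (h1, h2, h3, i1, i2, i3)).
have E' := (rev _ _ _ e1, rev _ _ _ e2, rev _ _ _ e3, rev _ _ _ e4,
  rev _ _ _ e5, rev _ _ _ e6, (rev _ _ _ f1, rev _ _ _ f2, rev _ _ _ f3,
  rev _ _ _ f4, rev _ _ _ f5, rev _ _ _ g1, rev _ _ _ g2, rev _ _ _ g3,
  rev _ _ _ g4), (rev _ _ _ h1, rev _ _ _ h2, rev _ _ _ h3, rev _ _ _ i1,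
  rev _ _ _ i2, rev _ _ _ i3)).
clear -E E' alt.
case: x; case: y; rewrite /= linearZl_LR linearZr_LR /= ?alt ?E ?E' ?oppr0
  ?scaler0 ?scale0r // ?scalerN -?scaleNr !scalerA; by congr (_ *: _); field.
Qed.

Lemma mon_eval_basis g m :
  mon_eval alpha (basis_vec \o g) m =
  (basis_eval g m).1%:~R *: basis_vec (basis_eval g m).2.
Proof.
elim: m => [i|a IHa b IHb] /=; first by rewrite scale1r.
case: (basis_eval g a) IHa (basis_eval g b) IHb => c x /= -> [d y] /= ->.
rewrite linearZl_LR linearZr_LR /= alpha_basis; case: (basis_mul x y) => e z /=.
by rewrite !scalerA !intrM.
Qed.

Lemma phiE n m : (phi n m)%:~R =
  \sum_(g <- [seq (g.1%:~R, basis_vec \o nth H g.2) | g <- probes n])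
    g.1 * coord_sum (mon_eval alpha g.2 m).
Proof.
rewrite big_map /phi; elim: (probes n) => [|g G IHG] /=.
  by rewrite big_nil.
rewrite big_cons intrD intrM IHG mon_eval_basis linearZ /=.
by rewrite coord_sum_basis mulr1.
Qed.

End Octonions.

Theorem proposition4p6 (R : realType)
    (alpha : {bilinear V6 R -> V6 R -> V6 R})
    (halpha : normalized_morphism alpha)
    (p : napoly R[i]) (hdeg : degree_le 5 p) (hp : satisfies alpha p) :
  consequence [:: anticomm_id R[i]; malcev_id R[i]; k_id R[i]] p.
Proof.
move=> A mul idsA s.
have [anticommA malcevA kA] : [/\ satisfies mul (anticomm_id R[i]),
    satisfies mul (malcev_id R[i]) & satisfies mul (k_id R[i])].
  move: (anticomm_id _) (malcev_id _) (k_id _) idsA => q1 q2 q3 idsA.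
  by split; apply: idsA; rewrite !inE eqxx ?orbT.
apply: (na_eval_by_degree hdeg) => n le_n5.
apply: (transfer_identity hp (D := (denom n)%:~R)
  (probe := [seq (g.1%:~R, basis_vec R \o nth H g.2) | g <- probes n])
  (eps := @coord_sum R) (Y := fun u => mon_eval mul s (left_normed u))).
  by rewrite intr_eq0; case: (n) => [|[|[|[|[]]]]].
move=> m' degm'.
rewrite (projection_formula anticommA malcevA kA s le_n5 degm').
by apply: eq_bigr => r _; rewrite (phiE halpha).
Qed.
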